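(* Let $Q$ be a quasifield and let $n$ be a natural number. Then the set $\operatorname{QRad} Q\{y_1,\ldots,y_n\}$ of all quasiradical ideals of the ring of differential polynomials $Q\{y_1,\ldots,y_n\}$, partially ordered by inclusion, is $\omega$-noetherian.
   Context: A differential ring is a commutative associative unital ring with a fixed finite set $\Delta$ of pairwise commuting derivations (the same $\Delta$ for all rings). $\Theta$ is the free commutative monoid generated by $\Delta$, acting as derivative operators. All rings have nonzero characteristic. A quasifield is a nonzero differential ring of nonzero characteristic whose only differential ideals are $0$ and the whole ring. $Q\{y_1,\ldots,y_n\}$ is the polynomial ring over $Q$ in the indeterminates $\theta y_i$ ($\theta\in\Theta$, $1\le i\le n$) with the obvious derivations. An element $x$ of a differential ring is a differential nilpotent if $\theta x$ is nilpotent for every $\theta\in\Theta$. A differential ideal $\mathfrak u$ of a differential ring $A$ is quasiradical if $A/\mathfrak u$ has no nonzero differential nilpotents. A partially ordered set $S$ is $\omega$-noetherian if every strictly ascending chain of its elements is at most countable, where an ascending chain is a (transfinite) increasing family $(s_\alpha)_{\alpha<\lambda}$ indexed by an ordinal $\lambda$; i.e. every strictly increasing such family has countable $\lambda$. *)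

(* Defs.v *)
From HB Require Import structures.
From mathcomp Require Import all_boot all_order all_algebra.
From mathcomp Require Import finmap boolp classical_sets cardinality wochoice.
From mathcomp Require Import monalg ring.
Set Implicit Arguments.
Unset Strict Implicit.
Unset Printing Implicit Defensive.

Import Order.TTheory GRing.Theory.
Local Open Scope classical_set_scope.
Local Open Scope quotient_scope.
Local Open Scope ring_scope.

(* Nonzero characteristic is not part of the structure, see [quasifield].
   The zero ring is allowed: it occurs as the quotient by the unit ideal. *)
HB.mixin Record isDiffRing (D : finType) R of GRing.ComPzRing R := {
  der : D -> R -> R;
  derD : forall d x y, der d (x + y) = der d x + der d y;
  derM : forall d x y, der d (x * y) = der d x * y + x * der d y;
  derC : forall d e x, der d (der e x) = der e (der d x)
}.

#[short(type="diffRingType")]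
HB.structure Definition DiffRing (D : finType) :=
  {R of isDiffRing D R & GRing.ComPzRing R}.

#[short(type="nzDiffRingType")]
HB.structure Definition NzDiffRing (D : finType) :=
  {R of DiffRing D R & GRing.ComNzRing R}.

(* The free commutative monoid on D, written multiplicatively. *)
Notation theta D := {cmonom D}.

Section DiffRingTheory.
Context {D : finType} {A : diffRingType D}.
Implicit Types (d : D) (t : theta D) (x y : A) (I : set A).

(* The order of the factors is immaterial by [derC]. *)
Definition dop t x : A := foldr (fun d => iter (t d) (der d)) x (enum D).

Lemma der0 d : der d 0 = 0 :> A.
Proof. by apply: (addrI (der d 0)); rewrite -derD !addr0. Qed.

Lemma derN d x : der d (- x) = - der d x.
Proof. by apply: (addrI (der d x)); rewrite -derD !subrr der0. Qed.

Lemma der1 d : der d 1 = 0 :> A.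
Proof.
by apply: (addrI (der d 1)); rewrite addr0 -{3}[1 : A]mulr1 derM mulr1 mul1r.
Qed.

HB.instance Definition _ d :=
  GRing.isZmodMorphism.Build A A (der d)
    (fun x y => etrans (derD d x (- y)) (congr1 (+%R (der d x)) (derN d y))).

Definition nilpotent x : Prop := exists k : nat, x ^+ k = 0.

Definition diff_nilpotent x : Prop := forall t, nilpotent (dop t x).

Definition diff_ideal I : Prop :=
  [/\ I 0,
      forall x y, I x -> I y -> I (x + y),
      forall a x, I x -> I (a * x) &
      forall d x, I x -> I (der d x)].

End DiffRingTheory.

(* That Q is not the zero ring is part of [nzDiffRingType]. *)
Definition quasifield (D : finType) (Q : nzDiffRingType D) : Prop :=
  (exists2 m : nat, (0 < m)%N & m%:R = 0 :> Q) /\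
  forall I : set Q, diff_ideal I -> I = [set 0] \/ I = setT.

Section DiffQuotient.
Context {D : finType} {A : diffRingType D} {I : set A} (hI : diff_ideal I).

(* [hI] is a phantom argument, on which the instance below depends. *)
Definition ideal_pred of diff_ideal I : A -> bool := fun x => `[< I x >].

Lemma ideal_predE x : (x \in ideal_pred hI) = `[< I x >].
Proof. by []. Qed.

Lemma ideal_pred_zmod_closed : zmod_closed (ideal_pred hI).
Proof.
have [I0 ID IM _] := hI; split=> [|x y]; rewrite !ideal_predE; first exact/asboolP.
move=> /asboolP Ix /asboolP Iy; apply/asboolP/ID => //.
by rewrite -mulN1r; apply: IM.
Qed.

HB.instance Definition _ :=
  GRing.isZmodClosed.Build A (ideal_pred hI) ideal_pred_zmod_closed.

Definition diff_quot : Type :=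
  Quotient.quot (GRing.ZmodClosed.clone A (ideal_pred hI) _).

HB.instance Definition _ := GRing.Zmodule.on diff_quot.
HB.instance Definition _ := ZmodQuotient.on diff_quot.

Local Notation pi := (\pi_diff_quot).

Lemma pi_eqP x y : pi x = pi y <-> I (x - y).
Proof.
split=> [/eqP|Ixy].
  by rewrite -[_ == _]Quotient.idealrBE ideal_predE => /asboolP.
by apply/eqP; rewrite -[_ == _]Quotient.idealrBE ideal_predE; apply/asboolP.
Qed.

Definition dq_one : diff_quot := pi 1.
Definition dq_mul (x y : diff_quot) : diff_quot := pi (repr x * repr y).
Definition dq_der (d : D) (x : diff_quot) : diff_quot := pi (der d (repr x)).

Lemma repr_pi x : I (repr (pi x) - x).
Proof. by apply/pi_eqP; rewrite reprK. Qed.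

Lemma dq_mulE x y : dq_mul (pi x) (pi y) = pi (x * y).
Proof.
have [_ ID IM _] := hI; apply/pi_eqP; set u := repr _; set v := repr _.
have -> : u * v - x * y = v * (u - x) + x * (v - y).
  by rewrite !mulrBr [v * u]mulrC [v * x]mulrC addrA subrK.
by apply: ID; apply: IM; apply: repr_pi.
Qed.

Lemma dq_derE d x : dq_der d (pi x) = pi (der d x).
Proof.
by have [_ _ _ Id] := hI; apply/pi_eqP; rewrite -raddfB; apply/Id/repr_pi.
Qed.

Lemma dq_addE x y : pi x + pi y = pi (x + y).
Proof. by rewrite raddfD. Qed.

Lemma dq_mulA : associative dq_mul.
Proof.
elim/quotW=> x; elim/quotW=> y; elim/quotW=> z.
by rewrite (dq_mulE y z) (dq_mulE x y) !dq_mulE mulrA.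
Qed.

Lemma dq_mulC : commutative dq_mul.
Proof.
by elim/quotW=> x; elim/quotW=> y; rewrite (dq_mulE x y) (dq_mulE y x) mulrC.
Qed.

Lemma dq_mul1 : left_id dq_one dq_mul.
Proof. by elim/quotW=> x; rewrite (dq_mulE 1 x) mul1r. Qed.

Lemma dq_mulDl : left_distributive dq_mul +%R.
Proof.
elim/quotW=> x; elim/quotW=> y; elim/quotW=> z.
by rewrite (dq_mulE x z) (dq_mulE y z) !dq_addE dq_mulE mulrDl.
Qed.

HB.instance Definition _ := GRing.Zmodule_isComPzRing.Build diff_quot
  dq_mulA dq_mulC dq_mul1 dq_mulDl.

Lemma dq_derD d (x y : diff_quot) : dq_der d (x + y) = dq_der d x + dq_der d y.
Proof.
elim/quotW: x => x; elim/quotW: y => y.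
by rewrite dq_addE (dq_derE d x) (dq_derE d y) dq_derE dq_addE derD.
Qed.

Lemma dq_derM d (x y : diff_quot) :
  dq_der d (x * y) = dq_der d x * y + x * dq_der d y.
Proof.
have mE a b : pi a * pi b = pi (a * b) by exact: dq_mulE.
elim/quotW: x => x; elim/quotW: y => y.
by rewrite mE (dq_derE d x) (dq_derE d y) dq_derE !mE dq_addE derM.
Qed.

Lemma dq_derC d e (x : diff_quot) :
  dq_der d (dq_der e x) = dq_der e (dq_der d x).
Proof.
by elim/quotW: x => x; rewrite (dq_derE e x) (dq_derE d x) !dq_derE derC.
Qed.

HB.instance Definition _ := isDiffRing.Build D diff_quot dq_derD dq_derM dq_derC.

Lemma pi_der d x : der d (pi x) = pi (der d x).
Proof. exact: dq_derE. Qed.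

Lemma pi_dop t x : dop t (pi x) = pi (dop t x).
Proof.
rewrite /dop; elim: (enum D) => //= d s ->.
by elim: (t d) => //= k ->; rewrite pi_der.
Qed.

Lemma pi_exp x k : pi x ^+ k = pi (x ^+ k).
Proof. by elim: k => // k IHk; rewrite !exprS IHk; exact: dq_mulE. Qed.

Lemma pi_eq0 x : pi x = 0 <-> I x.
Proof. by rewrite -(raddf0 pi) pi_eqP subr0. Qed.

End DiffQuotient.

Definition quasiradical (D : finType) (A : diffRingType D) (I : set A) : Prop :=
  exists hI : diff_ideal I,
    forall x : diff_quot hI, diff_nilpotent x -> x = 0.

Definition QRad (D : finType) (A : diffRingType D) : set (set A) :=
  [set I | quasiradical I].
Arguments QRad {D} A.

Lemma quasiradicalP (D : finType) (A : diffRingType D) (I : set A) :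
  quasiradical I <->
  diff_ideal I /\
  forall x : A, (forall t : theta D, exists k : nat, I (dop t x ^+ k)) -> I x.
Proof.
split=> [[hI nil0]|[hI nilI]]; [split=> // x xI|exists hI => x].
  apply/(pi_eq0 hI)/nil0 => t; have [k Ik] := xI t.
  by exists k; rewrite pi_dop pi_exp; apply/pi_eq0.
elim/quotW: x => x xnil; apply/pi_eq0/nilI => t; have [k] := xnil t.
by rewrite pi_dop pi_exp => /pi_eq0; exists k.
Qed.

Section DiffPoly.
#[local] Opaque mulcm divcm ucm onecm mkmalgU fgmul fgadd.
Context {D : finType}.
Implicit Types (d : D) (t : theta D).

(* The pair (t, i) stands for the indeterminate t y_i. *)
Definition diffpoly (Q : nzDiffRingType D) (n : nat) : Type :=
  {malg Q[{cmonom (theta D * 'I_n)%type}]}.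

Context (Q : nzDiffRingType D) (n : nat).
Local Notation V := (theta D * 'I_n)%type.
Local Notation P := {malg Q[{cmonom V}]}.
Implicit Types (c : Q) (v w : V) (m : {cmonom V}) (f g : P).

Definition der_var d v : V := (mmul (ucm d) v.1, v.2).

(* The sum over v of (dm/dv) * (der_var d v) *)
Definition der_mon d m : P :=
  \sum_(v <- finsupp m)
    << (m v)%:R *g mmul (divcm m (ucm v)) (ucm (der_var d v)) >>.

(* [mmap h k f] is the sum over m of h f@_m * k m. *)
Definition der_poly d f : P :=
  mmap (@malgC _ Q \o der d) (fun m => << m >> : P) f
  + mmap (@malgC _ Q) (der_mon d) f.

Lemma malgUU (a b : Q) m1 m2 :
  << a *g m1 >> * << b *g m2 >> = << a * b *g mmul m1 m2 >> :> P.
Proof. exact: fgmulUU. Qed.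

Lemma malgUC c m : << c *g m >> = malgC c * << m >> :> P.
Proof. by rewrite malgUU mulr1 mul1m. Qed.

Lemma malgX1M m1 m2 : << mmul m1 m2 >> = << m1 >> * << m2 >> :> P.
Proof. by rewrite malgUU mulr1. Qed.

Lemma malgCM a b : malgC (a * b) = malgC a * malgC b :> P.
Proof. by rewrite malgUU mulm1. Qed.

Lemma malgCD a b : malgC (a + b) = malgC a + malgC b :> P.
Proof. exact: monalgUD. Qed.

Lemma der_polyU d c m :
  der_poly d << c *g m >> = << der d c *g m >> + malgC c * der_mon d m.
Proof.
rewrite /der_poly; congr (_ + _); last exact: mmapU.
by rewrite [LHS]mmapU /= malgUU mulr1 mul1m.
Qed.

Lemma der_polyB d : zmod_morphism (der_poly d).
Proof.
move=> f g; rewrite opprD addrACA.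
by congr (_ + _); apply: mmapB.
Qed.

HB.instance Definition _ d :=
  GRing.isZmodMorphism.Build P P (der_poly d) (der_polyB d).

Lemma der_polyD d f g : der_poly d (f + g) = der_poly d f + der_poly d g.
Proof. exact: raddfD. Qed.

Lemma der_monEw d m (E : {fset V}) : (finsupp m `<=` E)%fset ->
  der_mon d m = \sum_(v <- E)
    << (m v)%:R *g mmul (divcm m (ucm v)) (ucm (der_var d v)) >>.
Proof.
move=> le; rewrite [LHS](big_fset_incl _ le) // => v _.
by rewrite -cmE_eq0 => /eqP->; rewrite monalgU0.
Qed.

Lemma mmulAC (M : conomType) : right_commutative (@mmul M).
Proof. by move=> x y z; rewrite -!mulmA [mmul y _]mulmC. Qed.

Lemma divcmMl m1 m2 v : m1 v != 0%N ->
  divcm (mmul m1 m2) (ucm v) = mmul (divcm m1 (ucm v)) m2.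
Proof.
move=> m1v; apply/eqP/cmP => w.
have eU := ucmE v w; have eM := mulcmE m1 m2 w.
have eD := divcmE m1 (ucm v) w; have eDM := divcmE (mmul m1 m2) (ucm v) w.
apply: etrans eDM _; apply/esym/(etrans (mulcmE (divcm m1 (ucm v)) m2 w)).
rewrite [X in (X + _)%N = _]eD [X in _ = (X - _)%N]eM.
rewrite [X in _ = (_ - X)%N]eU [X in ((_ - X) + _)%N = _]eU.
by case: eqVneq => [<-|_]; rewrite ?subn0 // addnBAC ?lt0n.
Qed.

Lemma der_monM d m1 m2 : der_mon d (mmul m1 m2) =
  der_mon d m1 * << m2 >> + << m1 >> * der_mon d m2.
Proof.
pose E := (finsupp m1 `|` finsupp m2)%fset.
rewrite (@der_monEw d _ E) ?mdomD // (@der_monEw d m1 E) ?fsubsetUl //.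
rewrite (@der_monEw d m2 E) ?fsubsetUr //.
rewrite mulr_suml.
rewrite [X in _ = _ + X]mulr_sumr.
rewrite -big_split; apply: eq_bigr => v _ /=.
rewrite cmM natrD; apply: etrans (monalgUD _ _ _) _.
congr (_ + _); apply/esym/(etrans (malgUU _ _ _ _)); rewrite ?mul1r ?mulr1.
- have [m1v|m1v] := eqVneq (m1 v) 0%N.
    by rewrite m1v mulr0n; apply: etrans (monalgU0 _) (esym (monalgU0 _)).
  apply: (congr1 (fun k : {cmonom V} => << (m1 v)%:R *g k >>)).
  apply: etrans (mmulAC _ _ _) _.
  exact/esym/(congr1 (mmul^~ _))/divcmMl.
- have [m2v|m2v] := eqVneq (m2 v) 0%N.
    rewrite m2v mulr0n.
    by apply: etrans (monalgU0 _) (esym (monalgU0 _)).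
  apply: (congr1 (fun k : {cmonom V} => << (m2 v)%:R *g k >>)).
  apply: etrans (mulmA _ _ _) _; apply: (congr1 (mmul^~ _)).
  apply: etrans (mulmC _ _) _; apply/esym; rewrite [mmul m1 m2]mulmC.
  exact: divcmMl.
Qed.

Lemma der_mon1 d : der_mon d mone = 0.
Proof. by rewrite /der_mon mdom1 big_seq_fset0. Qed.

Lemma der_monU d v : der_mon d (ucm v) = << ucm (der_var d v) >>.
Proof.
rewrite /der_mon mdomU big_seq_fset1 cmUU.
apply: (congr1 (fun k : {cmonom V} => << 1 *g k >>)).
apply: etrans (congr1 (mmul^~ _) _) (mul1m _).
by apply/eqP/cmP => w; rewrite divcmE subnn; apply/esym/cm1.
Qed.

#[local] Opaque der_poly der_mon.

Lemma dp_ind (T : P -> Prop) :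
  (forall c m, T << c *g m >>) -> (forall f g, T f -> T g -> T (f + g)) ->
  forall f, T f.
Proof.
move=> TU TD f; rewrite [f]monalgE; elim/big_ind: _ => //.
by rewrite -(monalgU0 (mone : {cmonom V})).
Qed.

Lemma der_mul_aux (R : comPzRingType) (a a' b b' m m' k k' : R) :
  (a' * b + a * b') * (m * k) + (a * b) * (m' * k + m * k') =
  (a' * m + a * m') * (b * k) + (a * m) * (b' * k + b * k').
Proof. by ring. Qed.

Lemma der_polyM d f g : der_poly d (f * g) = der_poly d f * g + f * der_poly d g.
Proof.
elim/dp_ind: f => [a m|f1 f2 IH1 IH2]; last first.
  rewrite (mulrDl f1 f2 g) (der_polyD d f1 f2) (der_polyD d (f1 * g)).
  rewrite [X in X + _ = _]IH1 [X in _ + X = _]IH2.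
  by apply: etrans (addrACA _ _ _ _) _; congr (_ + _); exact/esym/mulrDl.
elim/dp_ind: g => [b k|g1 g2 IH1 IH2]; last first.
  set f := << a *g m >> in IH1 IH2 *.
  rewrite (mulrDr f g1 g2) (der_polyD d g1 g2) (der_polyD d (f * g1)).
  rewrite [X in X + _ = _]IH1 [X in _ + X = _]IH2.
  by apply: etrans (addrACA _ _ _ _) _; congr (_ + _); exact/esym/mulrDr.
have EU c p : der_poly d << c *g p >> =
    malgC (der d c) * << p >> + malgC c * der_mon d p :> P.
  by apply: etrans (der_polyU d c p) _; congr (_ + _); exact: malgUC.
have Eab : malgC (der d (a * b)) =
    malgC (der d a) * malgC b + malgC a * malgC (der d b) :> P.
  apply: etrans (congr1 _ (derM d a b)) _; apply: etrans (malgCD _ _) _.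
  by congr (_ + _); exact: malgCM.
apply: etrans (congr1 (der_poly d) (malgUU a b m k)) _.
apply: etrans (EU (a * b) (mmul m k)) _.
apply: etrans (congr2 +%R (congr2 *%R Eab (malgX1M m k))
                          (congr2 *%R (malgCM a b) (der_monM d m k))) _.
apply: etrans (der_mul_aux _ _ _ _ _ _ _ _) _; apply: esym.
exact: (congr2 +%R (congr2 *%R (EU a m) (malgUC b k))
                   (congr2 *%R (malgUC a m) (EU b k))).
Qed.

Lemma der_polyC d c : der_poly d (malgC c) = malgC (der d c).
Proof.
apply: etrans (der_polyU d c mone) _.
by rewrite der_mon1 mulr0 addr0.
Qed.

Lemma der_polyX d v : der_poly d << ucm v >> = << ucm (der_var d v) >>.
Proof.
apply: etrans (der_polyU d 1 (ucm v)) _; rewrite der1 der_monU.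
apply: etrans (congr2 +%R (monalgU0 _) (malgUU _ _ _ _)) _.
by rewrite add0r mulr1 mul1m.
Qed.

Lemma dp_ring_ind (T : P -> Prop) :
  (forall c, T (malgC c)) -> (forall v, T << ucm v >>) ->
  (forall f g, T f -> T g -> T (f + g)) ->
  (forall f g, T f -> T g -> T (f * g)) ->
  forall f, T f.
Proof.
move=> TC TX TD TM; apply: dp_ind => // c m.
rewrite (malgUC c m); apply: (TM) => //.
have [k] := ubnP (mdeg m); elim: k m => // k IHk m.
have [->|m1] := eqVneq m mone; first by move=> _; apply: TC.
have [v mv] : exists v, m v != 0%N.
  apply: contrapT => /forallNP m0; case/eqP: m1; apply/eqP/cmP => v.
  by apply: etrans (esym (cm1 v)); apply/eqP/negPn/negP/m0.
have Em : m = mmul (ucm v) (divcm m (ucm v)).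
  apply/eqP/cmP => w; apply: etrans (esym (mulcmE (ucm v) _ w)).
  rewrite [X in (_ + X)%N](divcmE m (ucm v) w) [X in (X + _)%N](ucmE v w).
  rewrite [X in (_ - X)%N](ucmE v w).
  by case: eqVneq => [<-|_]; rewrite ?subn0 // subnKC ?lt0n.
rewrite Em mdegM mdegU add1n ltnS => mk; rewrite (malgX1M (ucm v)).
by apply: (TM) => //; exact: IHk.
Qed.

Lemma der_com_aux (R : comPzRingType) (f g x x' y y' p q : R) :
  x = x' -> y = y' ->
  x * g + p + (q + f * y) = x' * g + q + (p + f * y').
Proof. by move=> -> ->; ring. Qed.

Lemma der_polyCom d e f :
  der_poly d (der_poly e f) = der_poly e (der_poly d f).
Proof.
elim/dp_ring_ind: f => [c|v|f g IHf IHg|f g IHf IHg].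
- have EC a b : der_poly a (der_poly b (malgC c)) = malgC (der a (der b c)).
    by apply: etrans (congr1 _ (der_polyC b c)) _; exact: der_polyC.
  by apply: etrans (EC d e) _; rewrite derC; exact/esym/EC.
- have EX a b : der_poly a (der_poly b << ucm v >>) =
      << ucm (der_var a (der_var b v)) >>.
    by apply: etrans (congr1 _ (der_polyX b v)) _; exact: der_polyX.
  apply: etrans (EX d e) _; apply: etrans (esym (EX e d)).
  apply: (congr1 (fun w : V => << ucm w >>)); congr (_, _) => /=.
  by rewrite !mulmA [mmul (ucm d) _]mulmC.
- apply: etrans (congr1 _ (der_polyD e f g)) _.
  apply: etrans (esym (congr1 _ (der_polyD d f g))).
  apply: etrans (der_polyD d _ _) _; apply: etrans (congr2 +%R IHf IHg) _.
  exact/esym/der_polyD.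
- have EM a b : der_poly a (der_poly b (f * g)) =
      der_poly a (der_poly b f) * g + der_poly b f * der_poly a g +
      (der_poly a f * der_poly b g + f * der_poly a (der_poly b g)).
    apply: etrans (congr1 (der_poly a) (der_polyM b f g)) _.
    apply: etrans (der_polyD a _ _) _.
    by congr (_ + _); exact: der_polyM.
  refine (etrans (EM d e) (etrans _ (esym (EM e d)))).
  exact: (@der_com_aux P f g _ _ _ _ (der_poly e f * der_poly d g)
    (der_poly d f * der_poly e g) IHf IHg).
Qed.

HB.instance Definition _ :=
  isDiffRing.Build D P der_polyD der_polyM der_polyCom.
HB.instance Definition _ := NzDiffRing.on (diffpoly Q n).

Lemma diffpoly_derE d (f : diffpoly Q n) : der d f = der_poly d f.
Proof. by []. Qed.

End DiffPoly.

(* An ordinal-indexed chain in S is a strictly increasing family indexed by an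
   arbitrary well-ordered type L; [R] is the large order on L. *)
Definition omega_noetherian disp (T : porderType disp) (S : set T) : Prop :=
  forall (L : Type) (R : rel L), well_order R ->
  forall s : L -> T, (forall a, S (s a)) ->
    (forall a b, R a b -> a <> b -> (s a < s b)%O) ->
  countable [set: L].

(* Main.v *)
(* A quasiradical ideal is the largest differential ideal inside its radical, so
   it is determined by that radical. Nonunits of Q are nilpotent, so a radical
   contains every monomial with a nonunit coefficient: modulo nonunits, it is
   a subspace of a vector space with a countable basis, the monomials. Hence
   its set of leading monomials, for any enumeration of the monomials, grows
   strictly along a strict chain, and a strict well-ordered chain of subsets of
   a countable set is countable. *)
Require Import Defs.
From mathcomp Require Import all_boot all_order all_algebra.
From mathcomp Require Import classical_sets.
From mathcomp Require Import finmap boolp cardinality wochoice monalg.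
Set Implicit Arguments.
Unset Strict Implicit.
Unset Printing Implicit Defensive.

Import Order.TTheory GRing.Theory.
Local Open Scope classical_set_scope.
Local Open Scope ring_scope.

(** * Countability of the monomials *)

Lemma countable_cmonom (I : choiceType) :
  countable [set: I] -> countable [set: {cmonom I}].
Proof.
move=> /countable_injP[e einj].
have {}einj : injective e by move=> x y; apply: einj; rewrite in_setT.
pose code (m : {cmonom I}) := [seq (e i, m i) | i <- finsupp m].
(* Only nonzero exponents are listed, so [m] and [m'] swap roles below when [m i] vanishes. *)
have codeP m m' i : code m = code m' -> m i != 0%N -> m' i = m i.
  rewrite cmE_eq0 negbK => eqc im.
  have /mapP[j _ [/einj <- ->//]] : (e i, m i) \in code m'.
  by rewrite -eqc; apply: map_f.
apply/countable_injP; exists (choice.pickle \o code) => m m' _ _ /=.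
move=> /(pcan_inj choice.pickleK) eqc.
apply/eqP/cmP => i; have [mi0|mi] := eqVneq (m i) 0%N; last exact/esym/codeP.
have [m'i0|m'i] := eqVneq (m' i) 0%N; first by rewrite mi0.
exact: codeP m'i.
Qed.

(** * Well-ordered chains of subsets *)

Section WellOrder.
Variables (L : Type) (R : rel L).
Hypothesis woR : well_order R.

Lemma wo_total a b : R a b \/ R b a.
Proof.
have [|z [[zin zmin] _]] := @woR [pred x : L | `[< x = a \/ x = b >]].
  by exists a; rewrite inE; apply/asboolP; left.
have aR : R z a by apply: zmin; rewrite inE; apply/asboolP; left.
have bR : R z b by apply: zmin; rewrite inE; apply/asboolP; right.
by move: zin; rewrite inE => /asboolP[] <-; [left|right].
Qed.

(** Both elements are minima of the pair, and [well_order] makes minima unique. *)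
Lemma wo_anti a b : R a b -> R b a -> a = b.
Proof.
move=> ab ba.
have [|z [_ zU]] := @woR [pred x : L | `[< x = a \/ x = b >]].
  by exists a; rewrite inE; apply/asboolP; left.
have refl x : R x x by case: (wo_total x x).
rewrite -(zU a) ?(zU b) //; split; try by rewrite inE; apply/asboolP; tauto.
  by move=> x; rewrite inE => /asboolP[] ->.
by move=> x; rewrite inE => /asboolP[] ->.
Qed.

(* Each [a] that is not the largest index is sent to an element of [F b]
   outside [F a], where [b] is the successor of [a]. *)
Lemma countable_wo_chain (M : Type) (F : L -> set M) :
  countable [set: M] ->
  (forall a b, R a b -> F a `<=` F b) ->
  (forall a b, R a b -> a <> b -> exists2 x, F b x & ~ F a x) ->
  countable [set: L].
Proof.
move=> /countable_injP[e einj] Fle Flt.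
have {}einj : injective e by move=> x y; apply: einj; rewrite in_setT.
have step a : exists k : option nat,
    if k is Some j then
      exists x, [/\ e x = j, ~ F a x & forall b, R a b -> a <> b -> F b x]
    else forall b, R b a.
  have [[b [ab nab]]|/forallNP amax] := pselect (exists b, R a b /\ a <> b);
    last first.
    exists None => b; case: (wo_total b a) => // ab.
    by have [->|ne] := pselect (a = b); [case: (wo_total b b)|case: (amax b)].
  have [|z [[zin zmin] _]] := @woR [pred x : L | `[< R a x /\ a <> x >]].
    by exists b; rewrite inE; apply/asboolP.
  move: zin; rewrite inE => /asboolP[az naz].
  have [x Fzx nFax] := Flt _ _ az naz.
  exists (Some (e x)), x; split=> // c ac nac; apply: Fle Fzx.
  by apply: zmin; rewrite inE; apply/asboolP.
have [f fP] := choice step.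
apply/countable_injP; exists (choice.pickle \o f) => a b _ _ /=.
move=> /(pcan_inj choice.pickleK) fab.
have := fP a; have := fP b; rewrite -fab; case: (f a) => [j|]; last first.
  by move=> amax bmax; apply: wo_anti.
move=> [y [ey nFby Fy]] [x [ex nFax Fx]].
have exy : x = y by apply: einj; rewrite ex ey.
(* If [a] comes first, its witness lies in [F b], but the equal witness of [b] avoids [F b]. *)
apply: contrapT => nab; case: (wo_total a b) => [ab|ba].
  by apply: nFby; rewrite -exy; apply: Fx.
by apply: nFax; rewrite exy; apply: Fy => // /esym.
Qed.

End WellOrder.

(** * Leading monomials *)

Section Lead.
Variables (Q : comNzRingType) (M : choiceType) (e : M -> nat).
Hypothesis einj : injective e.
Implicit Types (S T : set {malg Q[M]}) (f : {malg Q[M]}).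

(** The leading coefficient is 1 because a nonunit one cannot be normalized. The order given by [e]
    need not respect products: only linear structure matters. *)
Definition lead S : set M :=
  [set m | exists f, [/\ S f, f@_m = 1 & forall k, (e m < e k)%N -> f@_k = 0]].

Definition submodule S : Prop :=
  [/\ S 0, forall f g, S f -> S g -> S (f + g) & forall c f, S f -> S (c *: f)].

Lemma lead_mono S T : S `<=` T -> lead S `<=` lead T.
Proof. by move=> ST m [f [/ST Tf fm fk]]; exists f. Qed.

(** Elimination from the top: subtracting from an element of [T] an element of [S] with the same
    leading term lowers the bound on [e] over its support. Terms with nonunit coefficients are in
    [S] already. *)
Lemma lead_sub S T : submodule S -> submodule T ->
  (forall (c : Q) m, (exists b, b * c = 1) \/ S << c *g m >>) ->
  S `<=` T -> lead T `<=` lead S -> T `<=` S.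
Proof.
move=> [S0 SD SZ] [T0 TD TZ] Sc ST leTS f Tf.
have TB g h : T g -> T h -> T (g - h).
  by move=> Tg Th; rewrite -scaleN1r; apply/TD/TZ.
suff main k g : T g -> (forall m, (k <= e m)%N -> g@_m = 0) -> S g.
  apply: (main (\max_(m <- msupp f) e m).+1) => // m mf.
  apply: mcoeff_outdom; apply/negP => mfs.
  by move: mf; rewrite ltnNge (leq_bigmax_seq _ mfs).
elim: k g => [|k IHk] g Tg gk.
  by rewrite (_ : g = 0) //; apply/malgP => m; rewrite mcoeff0 gk.
(* Since [e] need not be surjective, index [k] may be void; the bound then drops for free. *)
have [[m em]|noe] := pselect (exists m, e m = k); last first.
  apply: IHk => // m; rewrite leq_eqVlt => /predU1P[ek|/gk//].
  by case: noe; exists m.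
suff [h Sh [hm hk]] :
    exists2 h, S h & h@_m = g@_m /\ forall j, (k < e j)%N -> h@_j = 0.
  rewrite -(subrK h g); apply: SD => //; apply: IHk; first exact/TB/ST.
  move=> j; rewrite leq_eqVlt mcoeffB => /predU1P[ej|kj]; last first.
    by rewrite gk ?hk ?subrr.
  by rewrite (_ : j = m) ?hm ?subrr //; apply: einj; rewrite em.
(* For a unit coefficient, normalizing [g] puts [m] in [lead T]; the monic element of [S] found
   there is scaled back by [g@_m]. *)
have [[b bc]|Sgm] := Sc g@_m m.
  have [|h [Sh hm hk]] := leTS m.
    exists (b *: g); split; [exact: TZ|by rewrite mcoeffZ|move=> j].
    by rewrite em mcoeffZ => /gk->; rewrite mulr0.
  exists (g@_m *: h); first exact: SZ.
  rewrite mcoeffZ hm mulr1; split=> // j.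
  by rewrite mcoeffZ -em => /hk->; rewrite mulr0.
exists << g@_m *g m >>; first exact: Sgm.
 rewrite mcoeffUU; split=> // j.
by rewrite mcoeffU; case: eqP => // <-; rewrite em ltnn.
Qed.

End Lead.

(** * Radicals and quasiradical ideals *)

Section Radical.
Variable A : comPzRingType.
Implicit Types I : set A.

Definition radical I : set A := [set x | exists k, I (x ^+ k)].

Lemma radicalD I :
  (forall x y, I x -> I y -> I (x + y)) -> (forall a x, I x -> I (a * x)) ->
  forall x y, radical I x -> radical I y -> radical I (x + y).
Proof.
move=> ID IM x y [k Ik] [l Il]; exists (k + l)%N.
have I0 : I 0 by rewrite -(mul0r (x ^+ k)); apply: IM.
rewrite exprDn; elim/big_ind: _ => // i _; rewrite -mulr_natl; apply: (IM).
have [li|il] := leqP l i.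
  by rewrite -(subnK li) exprD mulrA; apply: (IM).
rewrite mulrC -addnBA ?(ltnW il)// [(k + (l - i))%N]addnC exprD.
by rewrite mulrA; apply: (IM).
Qed.

Lemma radicalM I : (forall a x, I x -> I (a * x)) ->
  forall a x, radical I x -> radical I (a * x).
Proof. by move=> IM a x [k Ik]; exists k; rewrite exprMn; apply: (IM). Qed.

End Radical.

(** All derivatives of an element of [I] stay in [I], hence are nilpotent modulo [J], and [J]
    absorbs differential nilpotents. So a quasiradical ideal is determined by its radical. *)
Lemma quasiradical_radical_le (D : finType) (A : diffRingType D) (I J : set A) :
  quasiradical I -> quasiradical J -> radical I `<=` radical J -> I `<=` J.
Proof.
move=> /quasiradicalP[[_ _ _ Id] _] /quasiradicalP[_ nilJ] IJ x Ix.
apply: nilJ => t; apply: IJ; exists 1%N; rewrite expr1 /dop.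
elim: (enum D) => //= d s IHs.
by elim: (t d) => //= k IHk; apply: Id.
Qed.

(** * Units and nilpotents of a quasifield *)

Lemma der_exp (D : finType) (A : diffRingType D) (d : D) (x : A) k :
  der d (x ^+ k) = k%:R * x ^+ k.-1 * der d x.
Proof.
elim: k => [|k IHk]; first by rewrite expr0 der1 !mul0r.
rewrite exprS derM IHk mulrC /= -natr1 mulrDl mulrDl mul1r addrC; congr (_ + _).
by case: k {IHk} => [|k]; rewrite ?mul0r ?mulr0 //= mulrA mulrCA -exprS.
Qed.

(* Powers by the characteristic are constants, so they generate differential
   ideals. *)
Lemma quasifield_unit_or_nil (D : finType) (Q : nzDiffRingType D) (c : Q) :
  quasifield Q -> (exists b, b * c = 1) \/ exists k, c ^+ k = 0.
Proof.
move=> [[m m0 mQ] simple].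
have [||] := simple [set x | exists a, x = a * c ^+ m].
- split=> [|x y [a ->] [b ->]|a x [b ->]|d x [a ->]].
  + by exists 0; rewrite mul0r.
  + by exists (a + b); rewrite mulrDl.
  + by exists (a * b); rewrite mulrA.
  + by exists (der d a); rewrite derM der_exp mQ !mul0r mulr0 addr0.
- move=> I0; right; exists m.
  suff : [set x | exists a, x = a * c ^+ m] (c ^+ m) by rewrite I0.
  by exists 1; rewrite mul1r.
- move=> IT; left.
  have [a a1] : [set x | exists a, x = a * c ^+ m] 1 by rewrite IT.
  by exists (a * c ^+ m.-1); rewrite -mulrA -exprSr prednK.
Qed.

Theorem theorem17 (D : finType) (Q : nzDiffRingType D) (n : nat) :
  quasifield Q -> omega_noetherian (QRad (diffpoly Q n)).
Proof.
move=> qfQ L R woR s sQ slt.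
have cD : countable [set: theta D].
  exact/countable_cmonom/countableP.
have cV : countable [set: (theta D * 'I_n)%type].
  by rewrite -setXTT; apply: countableX.
have cM := countable_cmonom cV.
have /countable_injP[e einj'] := cM.
have einj : injective e by move=> x y; apply: einj'; rewrite in_setT.
pose r a : set {malg Q[{cmonom (theta D * 'I_n)%type}]} := radical (s a).
have le a b : R a b -> r a `<=` r b.
  have [<- _|nab ab x [k]] := pselect (a = b); first by [].
  have := slt _ _ ab nab; rewrite lt_neqAle => /andP[_ /subsetPset sab] /sab.
  by exists k.
have rsub a : submodule (r a).
  have /quasiradicalP[[I0 ID IM Id] _] := sQ a.
  split=> [|f g|c f]; [by exists 1%N|exact: radicalD|].
  by rewrite -mul_malgC; apply: radicalM.
apply: (countable_wo_chain woR (F := fun a => lead e (r a)) cM).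
  by move=> a b /le; apply: lead_mono.
move=> a b ab nab.
have := slt _ _ ab nab; rewrite lt_neqAle => /andP[/eqP neq /subsetPset sab].
(* Without a new leading monomial the two radicals agree, hence so do the ideals, against
   strictness. *)
apply: contrapT => noex; apply: neq; apply/seteqP; split=> //.
apply: (quasiradical_radical_le (sQ b) (sQ a)).
apply: (lead_sub einj (rsub a) (rsub b)) => [c m||]; [|exact: le|].
  have [|[k ck]] := quasifield_unit_or_nil c qfQ; [by left|right].
  have /quasiradicalP[[I0 _ IM _] _] := sQ a.
  by exists k; rewrite malgUC mul_malgC exprZn ck scale0r.
by move=> m lm; apply: contrapT => nlm; apply: noex; exists m.
Qed.
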